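(* Let $G$ and $G'$ be finitely generated Abelian groups. (1) If $$\{\beta_{G,S} \mid S \text{ is a finite symmetric generating set of } G\} = \{\beta_{G',S'} \mid S' \text{ is a finite symmetric generating set of } G'\},$$ then $\operatorname{rk} G = \operatorname{rk} G'$ and $|\operatorname{tors} G| = |\operatorname{tors} G'|$. (2) If $$\{\beta_{G,S} \mid S \text{ is a finite monoid generating set of } G\} = \{\beta_{G',S'} \mid S' \text{ is a finite monoid generating set of } G'\},$$ then $\operatorname{rk} G = \operatorname{rk} G'$ and $|\operatorname{tors} G| = |\operatorname{tors} G'|$.
   Context: $\mathbb{N}$ contains $0$. A subset $A$ of a group is symmetric if $g^{-1} \in A$ for all $g \in A$. For a finitely generated group $G$ with neutral element $e$ and a finite monoid generating set $S \subset G$ (not necessarily symmetric; every element of $G$ is a finite, possibly empty, product of elements of $S$; a symmetric generating set of a group is in particular a monoid generating set), define $d_S(g,h) := \min\{ n \in \mathbb{N} \mid \exists s_1,\dots,s_n \in S : h^{-1} g = s_1 \cdots s_n\}$ for $g,h \in G$. The ball of radius $r \in \mathbb{N}$ is $B_{G,S}(r) := \{ g \in G \mid d_S(g,e) \le r\}$, and the growth function of $G$ with respect to $S$ is $\beta_{G,S} \colon \mathbb{N} \to \mathbb{N}$, $\beta_{G,S}(r) := |B_{G,S}(r)|$. For a finitely generated Abelian group $G$, $\operatorname{tors} G$ denotes the (finite) subgroup of all elements of finite order, and $\operatorname{rk} G$ denotes the rank of the free Abelian group $G/\operatorname{tors} G$. *)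

(* Defs.v *)
From HB Require Import structures.
From mathcomp Require Import all_boot all_order all_algebra.
From mathcomp Require Import finmap.
From mathcomp Require Import boolp classical_sets cardinality.

Set Implicit Arguments.
Unset Strict Implicit.
Unset Printing Implicit Defensive.

Import GRing.Theory.

Local Open Scope classical_set_scope.
Local Open Scope ring_scope.

(* Abelian groups are written additively: G : zmodType, so a product
   s_1 ... s_n becomes a sum and h^-1 g becomes - h + g. *)

Definition word_of_length (G : zmodType) (S : set G) (n : nat) (x : G) : Prop :=
  exists s : 'I_n -> G, (forall i, S (s i)) /\ x = \sum_(i < n) s i.

Definition monoid_generating (G : zmodType) (S : set G) : Prop :=
  forall x : G, exists n : nat, word_of_length S n x.

Definition group_generating (G : zmodType) (S : set G) : Prop :=
  monoid_generating (S `|` [set - x | x in S]).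

Definition finitely_generated (G : zmodType) : Prop :=
  exists S : set G, finite_set S /\ group_generating S.

Definition symmetric_subset (G : zmodType) (S : set G) : Prop :=
  forall x : G, S x -> S (- x).

(* The minimum is a genuine one as soon as S is a monoid generating set;
   the default value 0 is used only if - h + g is not a word in S. *)
Definition word_dist (G : zmodType) (S : set G) (g h : G) : nat :=
  xget 0%N [set n : nat | word_of_length S n (- h + g) /\
    forall m : nat, word_of_length S m (- h + g) -> (n <= m)%N].

Definition ball (G : zmodType) (S : set G) (r : nat) : set G :=
  [set g | (word_dist S g 0 <= r)%N].

(* fset_set A is the finite set underlying A when A is finite (and empty
   otherwise); balls of finite monoid generating sets are finite. *)
Definition growth (G : zmodType) (S : set G) : nat -> nat :=
  fun r => #|` fset_set (ball S r)|.

Definition symmetric_growth_functions (G : zmodType) : set (nat -> nat) :=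
  [set growth S | S in [set S : set G |
    [/\ finite_set S, symmetric_subset S & group_generating S]]].

Definition monoid_growth_functions (G : zmodType) : set (nat -> nat) :=
  [set growth S | S in [set S : set G | finite_set S /\ monoid_generating S]].

Definition tors (G : zmodType) : {pred G} :=
  fun x => `[< exists n : nat, (0 < n)%N /\ x *+ n = 0 >].

Lemma tors_zmod_closed (G : zmodType) : zmod_closed (@tors G).
Proof.
split; first by apply/asboolP; exists 1%N.
move=> x y /asboolP[m [m0 xm]] /asboolP[n [n0 yn]].
apply/asboolP; exists (m * n)%N; split; first by rewrite muln_gt0 m0.
by rewrite mulrnBl mulrnA xm mul0rn mulnC mulrnA yn mul0rn subr0.
Qed.

HB.instance Definition _ (G : zmodType) :=
  GRing.isZmodClosed.Build G (@tors G) (@tors_zmod_closed G).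

Definition free_abelian_of_rank (Q : zmodType) (n : nat) : Prop :=
  exists b : 'I_n -> Q, forall x : Q,
    exists! c : {ffun 'I_n -> int}, x = \sum_(i < n) b i *~ c i.

(* G / tors G is free Abelian of exactly one rank when G is finitely
   generated; the default value 0 is used only if it is not free of finite
   rank. *)
Definition rk (G : zmodType) : nat :=
  xget 0%N [set n : nat | free_abelian_of_rank (Quotient.quot (@tors G)) n].

(* tors G is finite when G is finitely generated *)
Definition card_tors (G : zmodType) : nat := #|` fset_set [set` @tors G]|.

(* Main.v *)
Require Import Defs.
From mathcomp Require Import all_boot all_order all_algebra.
From mathcomp Require Import classical_sets.
From HB Require Import structures.
From mathcomp Require Import finmap boolp cardinality.
From mathcomp Require Import zify.

(** Let [d] be the rank of [G] and [t] the order of its torsion subgroup, so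
that there is a surjection of [G] onto the lattice [Z^d] whose kernel has [t]
elements ([tors_free_quotient], [finite_tors]).  Growth functions can be moved
along this surjection in both directions:
- pulling back a generating set [S0] of [Z^d] to the preimage of [S0] and [0]
  gives a growth function [f] of [G] with [f r <= t * f0 r]
  ([growths_pullback]);
- pushing forward a generating set of [G] gives a growth function [f0] of
  [Z^d] with [t * f0 r <= f (r + k)], where [k] is the radius of a ball
  containing the torsion subgroup ([growths_pushforward]).

If every growth function of [G] is one of [G'], with invariants [d'] and [t'],
then composing the two moves sends every growth function [f0] of [Z^d] to a
growth function [f1] of [Z^d'] with [t' * f1 r <= t * f0 (r + k)]
([growth_transfer]).  Two crude estimates on lattices are enough to conclude:
the standard generators give a growth function at most [(2 r + 1)^d]
([standard_growth]), and every growth function of [Z^d] satisfies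
[(r + 1)^d <= f (d r)] because a generating set contains [d] independent
vectors ([lattice_growth_lower]).

Comparing degrees, one transfer gives [d' <= d] ([leq_rk]).  If [d' = d],
transfers can be iterated: [n] of them bound [t'^n * (r + 1)^d] by
[t^n * (2 (d r + k) + 1)^d] for some [k] depending on [n].  Taking [r = k]
eliminates [k] and leaves [t'^n <= C * t^n] with [C] independent of [n], so
[t' <= t] ([leq_card_tors]).  This avoids limits, leading coefficients of growth
functions and volumes altogether.  Exchanging [G] and [G'] gives equality.  All
the moves respect symmetry of generating sets, so both parts of the theorem have
the same proof, parametrized by a boolean. *)

Set Implicit Arguments.
Unset Strict Implicit.
Unset Printing Implicit Defensive.

Import Order.TTheory GRing.Theory Num.Theory.

Local Open Scope classical_set_scope.
Local Open Scope ring_scope.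

(** * Cardinals of finite sets *)

Lemma leq_fset_set (T : choiceType) (A B : set T) :
  finite_set B -> A `<=` B -> (#|` fset_set A| <= #|` fset_set B|)%N.
Proof.
move=> finB AB; apply: fsubset_leq_card.
by rewrite -fset_set_sub //; apply: sub_finite_set AB finB.
Qed.

Lemma leq_fset_set_surj (T U : choiceType) (A : set T) (B : set U)
    (f : T -> U) :
  finite_set A -> B `<=` f @` A -> (#|` fset_set B| <= #|` fset_set A|)%N.
Proof.
move=> finA BA; apply: leq_trans (leq_fset_set (finite_image f finA) BA) _.
by rewrite fset_set_image // leq_imfset_card.
Qed.

Lemma leq_fset_set_inj (T U : choiceType) (A : set T) (B : set U)
    (f : T -> U) :
  finite_set A -> finite_set B ->
  (forall x y, A x -> A y -> f x = f y -> x = y) ->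
  (forall x, A x -> B (f x)) ->
  (#|` fset_set A| <= #|` fset_set B|)%N.
Proof.
move=> finA finB injf fAB.
have <- : #|` fset_set (f @` A)| = #|` fset_set A|.
  rewrite fset_set_image // card_in_imfset //= => x y.
  by rewrite !in_fset_set // => /set_mem Ax /set_mem Ay; apply: injf.
by apply: leq_fset_set => // _ [x Ax <-]; apply: fAB.
Qed.

Lemma card_fset_setT (F : finType) : #|` fset_set [set: F]| = #|F|.
Proof.
rewrite cardfE; have bF (x : F) : x \in fset_set [set: F].
  by rewrite in_fset_set; [apply: mem_set|apply: finite_finset].
apply: (bij_eq_card (f := val)); exists (fun x => [` bF x]%fset) => // x.
exact: val_inj.
Qed.

Lemma card_fset_setX (T U : choiceType) (A : set T) (B : set U) :
  finite_set A -> finite_set B ->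
  (#|` fset_set (A `*` B)| = #|` fset_set A| * #|` fset_set B|)%N.
Proof.
move=> finA finB; rewrite fset_setX // -(size_allpairs pair).
apply/perm_size/uniq_perm; first exact: fset_uniq.
  by apply: allpairs_uniq => [||[? ?] [? ?] //]; apply: fset_uniq.
move=> [x y]; rewrite in_fsetM /=; apply/andP/allpairsP => [[Ax By]|].
  by exists (x, y).
by case=> [[x' y'] [Ax By [-> ->]]].
Qed.

(** * Words and balls *)

Section Words.
Variable G : zmodType.
Implicit Types (S : set G) (x y : G).

Lemma word_of_length0 S x : word_of_length S 0 x <-> x = 0.
Proof.
split=> [[s [_ ->]]|->]; first by rewrite big_ord0.
by exists (fun=> 0); split=> [[]|]; rewrite ?big_ord0.
Qed.

Lemma word_of_lengthS S n x :
  word_of_length S n.+1 x <->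
  exists s, exists y, [/\ S s, word_of_length S n y & x = s + y].
Proof.
split=> [[s [Ss ->]]|[s [y [Ss [t [St ->]] ->]]]].
  exists (s ord0), (\sum_(i < n) s (lift ord0 i)); split=> //.
    by exists (fun i => s (lift ord0 i)); split.
  by rewrite big_ord_recl.
exists (fun i => oapp t s (unlift ord0 i)); split.
  by move=> i; case: unliftP => [j|] _ /=.
rewrite big_ord_recl unlift_none /=; congr (_ + _).
by apply: eq_bigr => i _; rewrite liftK.
Qed.

Lemma word_of_length1 S x : S x -> word_of_length S 1 x.
Proof. by move=> Sx; exists (fun=> x); split=> //; rewrite big_ord1. Qed.

Lemma word_of_lengthD S m n x y :
  word_of_length S m x -> word_of_length S n y ->
  word_of_length S (m + n) (x + y).
Proof.
elim: m x => [|m IH] x; first by move=> /word_of_length0 ->; rewrite add0r.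
move=> /word_of_lengthS[s [z [Ss Sz ->]]] Sy; rewrite addSn.
by apply/word_of_lengthS; exists s, (z + y); split; rewrite ?addrA //; apply: IH.
Qed.

Lemma word_of_length_ind S (P : G -> Prop) :
  P 0 -> (forall s x, S s -> P x -> P (s + x)) ->
  forall n x, word_of_length S n x -> P x.
Proof.
move=> P0 PS; elim=> [|n IH] x; first by move=> /word_of_length0 ->.
by move=> /word_of_lengthS[s [y [Ss Sy ->]]]; apply: PS => //; apply: IH Sy.
Qed.

Lemma finite_word_of_length S n :
  finite_set S -> finite_set [set x | word_of_length S n x].
Proof.
move=> finS; elim: n => [|n IH].
  by apply: sub_finite_set (finite_set1 0) => x /word_of_length0.
apply: sub_finite_set (finite_image2 +%R finS IH) => x.
by move=> /word_of_lengthS[s [y [Ss Sy ->]]]; exists s => //; exists y.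
Qed.

(** Every element is the value of some word, so the minimum defining
[word_dist] exists and its default value never occurs. *)
Lemma ballP S r x : monoid_generating S ->
  ball S r x <-> exists2 n, (n <= r)%N & word_of_length S n x.
Proof.
move=> genS; rewrite /ball /= /word_dist oppr0 add0r.
have [n Sn] := genS x.
have /(xgetPex 0%N) : exists n, [set n : nat | word_of_length S n x /\
    forall m : nat, word_of_length S m x -> (n <= m)%N] n.
  have exn : exists n, `[< word_of_length S n x >] by exists n; apply/asboolP.
  case: (ex_minnP exn) => m /asboolP Sm minm.
  by exists m; split=> // k Sk; apply: minm; apply/asboolP.
set d := xget _ _ => -[Sd mind]; split=> [dr|[m mr Sm]]; first by exists d.
exact: leq_trans (mind _ Sm) mr.
Qed.

Lemma ball_le S r r' : (r <= r')%N -> ball S r `<=` ball S r'.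
Proof. by move=> rr' x; rewrite /ball /= => /leq_trans; apply. Qed.

Lemma finite_ball S r : finite_set S -> monoid_generating S ->
  finite_set (ball S r).
Proof.
move=> finS genS.
have := bigcup_finite (finite_II r.+1)
  (fun n _ => finite_word_of_length n finS).
by apply: sub_finite_set => x /(ballP _ _ genS)[n nr Sn]; exists n.
Qed.

Lemma ballD S r r' x y : monoid_generating S ->
  ball S r x -> ball S r' y -> ball S (r + r') (x + y).
Proof.
move=> genS /(ballP _ _ genS)[m mr Sx] /(ballP _ _ genS)[n nr Sy].
apply/(ballP _ _ genS); exists (m + n)%N; first exact: leq_add.
exact: word_of_lengthD.
Qed.

Lemma ball_sum S (I : finType) (F : I -> G) (c : I -> nat) :
  monoid_generating S -> (forall i, ball S (c i) (F i)) ->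
  ball S (\sum_i c i)%N (\sum_i F i).
Proof.
move=> genS SF; apply: (big_ind2 (fun r x => ball S r x)) => //.
  by apply/(ballP _ _ genS); exists 0%N => //; apply/word_of_length0.
by move=> *; apply: ballD.
Qed.

Lemma ballMn S s n : monoid_generating S -> S s -> ball S n (s *+ n).
Proof.
move=> genS Ss; elim: n => [|n IH].
  by apply/(ballP _ _ genS); exists 0%N => //; apply/word_of_length0.
rewrite mulrS -add1n; apply: ballD => //.
by apply/(ballP _ _ genS); exists 1%N => //; apply: word_of_length1.
Qed.

Lemma finite_sub_ball S (A : set G) : monoid_generating S -> finite_set A ->
  exists k, A `<=` ball S k.
Proof.
move=> genS finA; exists (\max_(x <- fset_set A) word_dist S x 0)%N => x Ax.
rewrite /ball /=; apply: (@leq_bigmax_seq _ _ xpredT (word_dist S ^~ 0)) => //.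
by rewrite in_fset_set //; apply: mem_set.
Qed.

Lemma symmetric_group_generating S : symmetric_subset S ->
  group_generating S <-> monoid_generating S.
Proof.
move=> symS; rewrite /group_generating; suff -> : S `|` [set - x | x in S] = S by [].
by apply/seteqP; split=> x; [case=> // -[y Sy <-]; apply: symS|left].
Qed.

End Words.

(** The boolean selects between the two families of generating sets, so that
every later argument treats them at once. *)
Definition generating (sym : bool) (G : zmodType) (S : set G) : Prop :=
  [/\ finite_set S, sym -> symmetric_subset S & monoid_generating S].

Definition growths (sym : bool) (G : zmodType) : set (nat -> nat) :=
  [set growth S | S in generating sym (G := G)].

Lemma symmetric_growthsE G : symmetric_growth_functions G = growths true G.
Proof.
apply/seteqP; split=> f; move=> [S [finS symS genS] <-]; exists S => //.
  by split=> //; apply/symmetric_group_generating.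
have {}symS := symS isT.
by split=> //; apply/symmetric_group_generating.
Qed.

Lemma monoid_growthsE G : monoid_growth_functions G = growths false G.
Proof.
apply/seteqP; split=> f; first by move=> [S [finS genS] <-]; exists S.
by move=> [S [finS _ genS] <-]; exists S.
Qed.

(** * Growth functions in an extension with finite kernel *)

Section Extension.
Variables (G Q : zmodType) (p : {additive G -> Q}).
Hypothesis p_surj : forall y, exists x, p x = y.
Let K := [set x | p x = 0].
Hypothesis finK : finite_set K.

Let lift y := xget 0 [set x | p x = y].
Let liftK y : p (lift y) = y.
Proof. by have [x px] := p_surj y; rewrite /lift; case: xgetP => // /(_ _ px). Qed.

Lemma preimage_sub (B : set Q) :
  p @^-1` B `<=` (fun u : G * Q => u.1 + lift u.2) @` (K `*` B).
Proof.
move=> x Bx; exists (x - lift (p x), p x); last by rewrite /= subrK.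
by split=> //=; rewrite /K /= raddfB liftK subrr.
Qed.

Lemma finite_preimage_ext (B : set Q) : finite_set B -> finite_set (p @^-1` B).
Proof.
move=> finB; apply: sub_finite_set (@preimage_sub B) _.
exact/finite_image/finite_setX.
Qed.

Lemma card_preimage_ext (B : set Q) : finite_set B ->
  (#|` fset_set (p @^-1` B)| <= #|` fset_set K| * #|` fset_set B|)%N.
Proof.
move=> finB; rewrite -card_fset_setX //.
exact: leq_fset_set_surj (finite_setX finK finB) (@preimage_sub B).
Qed.

(** The generating set is the preimage of [S0] together with [0]: adjoining [0]
puts the whole kernel into it, which makes it generate, and does not enlarge the
balls of [S0].  Balls upstairs therefore map into balls of [S0], and the fibres
of [p] are cosets of the kernel. *)
Lemma growths_pullback sym f0 : growths sym Q f0 ->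
  exists2 f, growths sym G f & forall r, (f r <= #|` fset_set K| * f0 r)%N.
Proof.
move=> [S0 [finS0 symS0 genS0] <-].
pose S := p @^-1` (S0 `|` [set 0]).
have lift_word n x : word_of_length S0 n (p x) -> exists m, word_of_length S m x.
  elim: n x => [|n IH] x.
    move=> /word_of_length0 px; exists 1%N; apply: word_of_length1.
    by right.
  move=> /word_of_lengthS[s [y [S0s S0y pxE]]].
  have [m Sm] : exists m, word_of_length S m (x - lift s).
    by apply: IH; rewrite raddfB liftK pxE addrC addKr.
  exists m.+1; apply/word_of_lengthS; exists (lift s), (x - lift s).
  by split=> //; [left; rewrite liftK|rewrite addrC subrK].
have genS : monoid_generating S by move=> x; have [n /lift_word] := genS0 (p x).
have finS : finite_set S.
  by apply: finite_preimage_ext; rewrite finite_setU; split.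
exists (growth S).
  exists S => //; split=> // /symS0 sS0 x; rewrite /S /= raddfN.
  by case=> [/sS0|->]; [left|right; rewrite oppr0].
move=> r; apply: leq_trans (card_preimage_ext (finite_ball r finS0 genS0)).
apply: leq_fset_set => [|x].
  exact/finite_preimage_ext/finite_ball.
move=> /(ballP _ _ genS)[n nr Sx]; apply: ball_le nr _ _ => {r}.
elim: n x Sx => [|n IH] x.
  move=> /word_of_length0 ->; rewrite /= raddf0; apply/(ballP _ _ genS0).
  by exists 0%N => //; apply/word_of_length0.
move=> /word_of_lengthS[s [y [Ss /IH Sy ->]]]; rewrite /= raddfD -add1n.
apply: ballD => //; apply/(ballP _ _ genS0).
by case: Ss => [|->]; [exists 1%N => //; exact: word_of_length1|
  exists 0%N => //; exact/word_of_length0].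
Qed.

(** Each element of a ball of [p @` S] lifts to the ball of [S] of the same
radius.  Translating the lifts by the kernel, which lies in some ball of radius
[k], produces distinct elements of the ball of radius [r + k]. *)
Lemma growths_pushforward sym f : growths sym G f ->
  exists2 f0, growths sym Q f0 &
    exists k, forall r, (#|` fset_set K| * f0 r <= f (r + k))%N.
Proof.
move=> [S [finS symS genS] <-]; pose S0 := p @` S.
have map_word n x : word_of_length S n x -> word_of_length S0 n (p x).
  move=> [s [Ss ->]]; exists (fun i => p (s i)).
  by split=> [i|]; [exists (s i)|rewrite raddf_sum].
have lift_word n y : word_of_length S0 n y ->
    exists2 x, word_of_length S n x & p x = y.
  elim: n y => [|n IH] y.
    by move=> /word_of_length0 ->; exists 0; rewrite ?raddf0 //; apply/word_of_length0.
  move=> /word_of_lengthS[_ [_ [[s Ss <-] /IH[x Sx <-] ->]]].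
  by exists (s + x); rewrite ?raddfD //; apply/word_of_lengthS; exists s, x.
have genS0 : monoid_generating S0.
  by move=> y; have [n /map_word] := genS (lift y); rewrite liftK; exists n.
have finS0 : finite_set S0 by apply: finite_image.
exists (growth S0).
  exists S0 => //; split=> // /symS sS _ [x Sx <-].
  by exists (- x); rewrite ?raddfN //; apply: sS.
have [k Kk] := finite_sub_ball genS finK.
exists k => r; rewrite -card_fset_setX //; last exact: finite_ball.
have pick y : exists x, ball S0 r y -> ball S r x /\ p x = y.
  have [/(ballP _ _ genS0)[n nr /lift_word[x Sx pxE]]|nB] := pselect (ball S0 r y).
    by exists x => _; split=> //; apply/(ballP _ _ genS); exists n.
  by exists 0.
have [g gP] := choice pick.
apply: (leq_fset_set_inj (f := fun u : G * Q => u.1 + g u.2)).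
- exact/finite_setX/finite_ball.
- exact: finite_ball.
- move=> [a y] [a' y'] [/= Ka /gP[_ py]] [/= Ka' /gP[_ py']] e.
  have eqy : y = y'.
    by have := congr1 p e; rewrite !raddfD Ka Ka' !add0r py py'.
  by move: e; rewrite eqy => /addIr ->.
- move=> [a y] [/= Ka /gP[gy _]]; rewrite addnC; apply: ballD => //.
  exact: Kk.
Qed.

End Extension.

(** * Finitely generated torsion-free groups are free *)

Section Freeness.
Variable Q : zmodType.

(** Generation is phrased as an induction principle over subgroups: changing a
generating family then only requires showing that the old generators lie in every
subgroup containing the new ones. *)
Definition spanning n (b : 'I_n -> Q) : Prop :=
  forall P : Q -> Prop, P 0 -> (forall x y, P x -> P y -> P (x - y)) ->
    (forall i, P (b i)) -> forall x, P x.

Hypothesis torsionfree : forall (x : Q) n, (0 < n)%N -> x *+ n = 0 -> x = 0.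

Lemma spanning_drop0 n (b : 'I_n.+1 -> Q) i : spanning b -> b i = 0 ->
  spanning (fun j => b (lift i j)).
Proof.
move=> sb bi0 P P0 PB Pb; apply: sb => // j.
by case: (unliftP i j) => [k|] ->; rewrite ?bi0.
Qed.

Lemma spanning_shear n (b : 'I_n -> Q) i j (e : int) : i != j -> spanning b ->
  spanning (fun k => if k == j then b j + b i *~ e else b k).
Proof.
move=> ij sb P P0 PB Pb.
have Pn (x : Q) (m : nat) : P x -> P (x *+ m).
  move=> Px; elim: m => // m IH; rewrite mulrSr -[x in _ + x]opprK.
  by apply: (PB) => //; rewrite -sub0r; apply: PB.
have Pz (x : Q) (m : int) : P x -> P (x *~ m).
  move=> Px; case: m => m; first exact: Pn.
  by rewrite NegzE mulrNz -sub0r; apply: PB => //; apply: Pn.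
have Pk k : k != j -> P (b k) by move=> kj; have := Pb k; rewrite (negPf kj).
apply: sb => // k; case: (eqVneq k j) => [->|/Pk //].
rewrite -[b j](addrK (b i *~ e)); apply: PB; first by have := Pb j; rewrite eqxx.
exact/Pz/Pk.
Qed.

(** A Euclidean algorithm on the coefficients of the relation.  If two of them
are nonzero, subtracting the smaller one from the larger, up to sign, while
shearing the generators accordingly keeps the relation true and decreases the sum
of the absolute values.  When a single nonzero coefficient is left, the
corresponding generator is torsion, hence zero, and can be dropped. *)
Lemma spanning_descent n (b : 'I_n.+1 -> Q) (a : 'I_n.+1 -> int) :
  spanning b -> (exists i, a i != 0) -> \sum_i b i *~ a i = 0 ->
  exists b' : 'I_n -> Q, spanning b'.
Proof.
have [N] := ubnP (\sum_i `|a i|)%N; elim: N => // N IH in a b * => aN sb [i0 ai0] rel.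
have [/existsP[i /existsP[j /and4P[ij ai aj le_ji]]]|/existsPn none] :=
  boolP [exists i, exists j,
           [&& i != j, a i != 0, a j != 0 & (`|a j| <= `|a i|)%N]].
- have [e lt_e] : exists e : int, (`|(a i - e * a j)%R| < `|a i|)%N.
    by case: (ltP 0 (a i * a j)) => s; [exists 1|exists (-1)]; nia.
  pose a' k := if k == i then a i - e * a j else a k.
  have sb' := spanning_shear (e := e) ij sb.
  apply: (IH a' _ _ sb').
  + move: aN; rewrite (bigD1 i) //= [in X in _ -> X](bigD1 i) //= {1}/a' eqxx.
    rewrite [in X in _ -> X](eq_bigr (fun k => `|a k|%N)); first by lia.
    by move=> k /negPf ki; rewrite /a' ki.
  + by exists j; rewrite /a' [j == i]eq_sym (negPf ij).
  + rewrite -[RHS]rel (bigD1 i) //= [RHS](bigD1 i) //= /a' eqxx (negPf ij).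
    have ji : j != i by rewrite eq_sym.
    rewrite (bigD1 j) //= [in RHS](bigD1 j) //= (negPf ji) eqxx.
    rewrite (eq_bigr (fun k => b k *~ a k)); last first.
      by move=> k /andP[/negPf -> /negPf ->].
    rewrite !addrA; congr (_ + _).
    rewrite mulrzBr mulrzDl -mulrzA [X in _ + X]addrC.
    by rewrite addrA addrNK.
- have a0 k : k != i0 -> a k = 0.
    move=> ki; apply/eqP/negPn/negP => ak.
    case: (leqP `|a k| `|a i0|) => [le|/ltnW le].
      by have /existsPn/(_ k) := none i0; rewrite eq_sym ki ai0 ak le.
    by have /existsPn/(_ i0) := none k; rewrite ki ai0 ak le.
  exists (fun j => b (lift i0 j)); apply: spanning_drop0 => //.
  move: rel; rewrite (bigD1 i0) //= big1 ?addr0; last by move=> k /a0 ->.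
  move: ai0; case: (a i0) => m ai0.
    by apply: torsionfree; rewrite -lt0n in ai0 *.
  by rewrite NegzE mulrNz => /eqP; rewrite oppr_eq0 => /eqP; apply: torsionfree.
Qed.

(** By descent on the number of generators, a shortest spanning family satisfies
no nontrivial relation, hence is a basis. *)
Lemma spanning_free n (b : 'I_n -> Q) : spanning b ->
  exists d, free_abelian_of_rank Q d.
Proof.
elim: n b => [|n IH] b sb.
  exists 0%N, b => x; exists [ffun=> 0]; split=> [|c _]; last by apply/ffunP => -[].
  by rewrite big_ord0; move: x; apply: sb => // [x y -> ->|[]//]; rewrite subr0.
have [[a [ai rel]]|indep] := pselect (exists a : 'I_n.+1 -> int,
    (exists i, a i != 0) /\ \sum_i b i *~ a i = 0).
  by have [b' /IH] := spanning_descent sb ai rel.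
exists n.+1, b => x.
have [c xE] : exists c : {ffun 'I_n.+1 -> int}, x = \sum_i b i *~ c i.
  move: x; apply: sb => [|_ _ [c ->] [c' ->]|i].
  - by exists 0; rewrite big1 // => i _; rewrite ffunE.
  - exists (c - c'); rewrite -sumrB; apply: eq_bigr => i _.
    by rewrite !ffunE mulrzBr.
  - exists [ffun j => (j == i)%:Z]; rewrite (bigD1 i) //= ffunE eqxx big1 ?addr0 //.
    by move=> j /negPf ji; rewrite ffunE ji.
exists c; split=> // c' xE'; apply/ffunP => i; apply: contrapT => ne.
case: indep; exists (fun i => c i - c' i); split.
  by exists i; rewrite subr_eq0; apply/eqP.
under eq_bigr do rewrite mulrzBr.
by rewrite sumrB -xE -xE' subrr.
Qed.

End Freeness.

(** * The free quotient and the torsion subgroup *)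

Lemma group_generating_ind (G : zmodType) (S : set G) (P : G -> Prop) :
  group_generating S -> P 0 -> (forall x y, P x -> P y -> P (x - y)) ->
  (forall s, S s -> P s) -> forall x, P x.
Proof.
move=> genS P0 PB PS x; have [n] := genS x.
have PN y : P y -> P (- y) by move=> Py; rewrite -sub0r; apply: PB.
apply: word_of_length_ind => // s y Ss Py; rewrite -[y]opprK.
by apply: PB; [case: Ss => [|[z Sz <-]]; [apply: PS|apply/PN/PS]|exact: PN].
Qed.

Lemma torsP (G : zmodType) (x : G) :
  reflect (exists2 n, (0 < n)%N & x *+ n = 0) (x \in @tors G).
Proof.
by apply: (iffP idP) => [/asboolP[n []]|[n n0 xn]]; [exists n|apply/asboolP; exists n].
Qed.

Lemma quotient_map (G : zmodType) (I : zmodClosed G) :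
  exists p : {additive G -> Quotient.quot I},
    (forall y, exists x, p x = y) /\ (forall x, p x = 0 <-> x \in I).
Proof.
exists \pi_(Quotient.quot I)%qT; split=> [y|x]; first by exists (repr y); apply: reprK.
have -> : (x \in I) = (x - 0 \in I) by rewrite subr0.
by rewrite Quotient.idealrBE raddf0; split=> /eqP.
Qed.

Lemma free_coordinates (Q : zmodType) d : free_abelian_of_rank Q d ->
  exists2 c : {additive Q -> {ffun 'I_d -> int}},
    injective c & forall y, exists x, c x = y.
Proof.
move=> [b freeb].
have exc x : exists c : {ffun 'I_d -> int}, x = \sum_i b i *~ c i.
  by have [c []] := freeb x; exists c.
have [c cE] := choice exc.
have uniq (u v : {ffun 'I_d -> int}) :
    \sum_i b i *~ u i = \sum_i b i *~ v i -> u = v.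
  by have [w [_ wP]] := freeb (\sum_i b i *~ u i) => e; rewrite -(wP u) // -(wP v).
have cB : zmod_morphism c.
  move=> x y; apply: uniq; rewrite -cE {1}(cE x) {1}(cE y) -sumrB.
  by apply: eq_bigr => i _; rewrite !ffunE mulrzBr.
pose ca : {additive Q -> {ffun 'I_d -> int}} :=
  HB.pack c (GRing.isZmodMorphism.Build _ _ c cB).
exists ca => [x y /= e|y]; first by rewrite (cE x) e -cE.
by exists (\sum_i b i *~ y i); apply: uniq; rewrite -cE.
Qed.

(** The quotient by the torsion subgroup is torsion-free and finitely generated,
hence free; this also shows that [rk G] is not the default value of its
definition. *)
Lemma tors_free_quotient (G : zmodType) : finitely_generated G ->
  exists2 p : {additive G -> {ffun 'I_(rk G) -> int}},
    (forall y, exists x, p x = y) & forall x, p x = 0 <-> x \in @tors G.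
Proof.
move=> [S [finS genS]]; have [p [p_surj p_ker]] := quotient_map (@tors G).
have free : free_abelian_of_rank (Quotient.quot (@tors G)) (rk G).
  apply: (@xgetPex nat 0%N
    [set n | free_abelian_of_rank (Quotient.quot (@tors G)) n]).
  pose s := fset_set S.
  (* An element whose multiple is torsion is itself torsion. *)
  apply: (@spanning_free _ _ (size s) (fun i => p s`_i)).
    move=> y n n0 yn; have [x px] := p_surj y; rewrite -px in yn *.
    apply/p_ker; move: yn; rewrite -raddfMn => /p_ker/torsP[m m0 xnm].
    by apply/torsP; exists (n * m)%N; rewrite ?muln_gt0 ?n0 // mulrnA.
  move=> P P0 PB Ps y; have [x <-] := p_surj y.
  apply: (@group_generating_ind _ _ (fun x => P (p x)) genS) => [|u v Pu Pv|u Su].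
  - by rewrite raddf0.
  - by rewrite raddfB; apply: PB.
  - have us : u \in (s : seq G) by rewrite in_fset_set //; apply: mem_set.
    by move: us; rewrite -index_mem => us; have := Ps (Ordinal us); rewrite /= nth_index // -index_mem.
have [c c_inj c_surj] := free_coordinates free.
exists (c \o p) => [y|x] /=.
  by have [z <-] := c_surj y; have [x <-] := p_surj z; exists x.
by rewrite -p_ker; split=> [|->]; rewrite ?raddf0 // -(raddf0 c) => /c_inj.
Qed.

Lemma ffunMzE (I : finType) (V : zmodType) (f : {ffun I -> V}) (m : int) i :
  (f *~ m) i = f i *~ m.
Proof. by case: m => m; rewrite ?NegzE ?mulrNz ?ffunE ffunMnE. Qed.

(** As [Z^d] is free, [p] has a section obtained by lifting the standard basis
vectors to [g i]; subtracting the section of [p x] from [x] retracts [G] onto the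
kernel of [p]. *)
Lemma torsion_retraction (G : zmodType) d (p : {additive G -> {ffun 'I_d -> int}}) :
  (forall y, exists x, p x = y) ->
  exists rho : {additive G -> G},
    (forall x, p (rho x) = 0) /\ (forall x, p x = 0 -> rho x = x).
Proof.
move=> p_surj.
pose e i : {ffun 'I_d -> int} := [ffun j => (j == i)%:Z].
have [g gP] := choice (fun i => p_surj (e i)).
pose rho x := x - \sum_i g i *~ p x i.
have rhoB : zmod_morphism rho.
  move=> x y; rewrite /rho; under eq_bigr do rewrite raddfB !ffunE mulrzBr.
  by rewrite sumrB !opprD !opprK addrACA.
pose rhoa : {additive G -> G} :=
  HB.pack rho (GRing.isZmodMorphism.Build _ _ rho rhoB).
exists rhoa; split=> x; rewrite /= /rho.
  rewrite raddfB raddf_sum; apply/ffunP => j; rewrite !ffunE sum_ffunE.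
  rewrite (bigD1 j) //= raddfMz gP big1 ?addr0.
    by rewrite ffunMzE ffunE eqxx intz subrr.
  move=> i ij; rewrite raddfMz gP ffunMzE ffunE.
  by rewrite eq_sym (negPf ij) mul0rz.
by move=> ->; rewrite big1 ?subr0 // => i _; rewrite ffunE.
Qed.

(** The retraction exhibits the torsion subgroup as generated by the finitely
many torsion elements [rho s] with [s] a generator.  If [N] kills all of them, the
coefficients in their combinations only matter modulo [N]. *)
Lemma finite_tors (G : zmodType) : finitely_generated G ->
  finite_set [set` @tors G].
Proof.
move=> fgG; have [p p_surj p_ker] := tors_free_quotient fgG.
have [rho [p_rho rho_id]] := torsion_retraction p_surj.
have [S [finS genS]] := fgG.
pose s := fset_set S; pose m := size s.
have /choice[o oP] : forall i : 'I_m, exists n, (0 < n)%N /\ rho s`_i *+ n = 0.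
  move=> i; have /p_ker/torsP[n] := p_rho s`_i.
  by exists n.
pose N := (\prod_i o i)%N.
have N0 : (0 < N)%N by rewrite prodn_gt0 // => i; case: (oP i).
have rhoN (i : 'I_m) : rho s`_i *+ N = 0.
  by rewrite /N (bigD1 i) //= mulrnA (oP i).2 mul0rn.
pose F (c : {ffun 'I_m -> 'I_N}) := \sum_(i < m) rho s`_i *+ c i.
have rhoF x : exists c, rho x = F c.
  suff [c xc] : exists c : 'I_m -> nat, rho x = \sum_(i < m) rho s`_i *+ c i.
    exists [ffun i => Ordinal (ltn_pmod (c i) N0)]; rewrite xc.
    apply: eq_bigr => i _; rewrite ffunE /= [in LHS](divn_eq (c i) N) mulrnDr.
    by rewrite mulnC mulrnA rhoN mul0rn add0r.
  move: x; apply: (group_generating_ind genS) => [|x y [c xc] [c' yc']|x Sx].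
  - by exists (fun=> 0%N); rewrite raddf0 big1.
  (* Modulo N, multiplication by N - 1 is negation. *)
  - exists (fun i => c i + c' i * N.-1)%N; rewrite raddfB xc yc' -sumrB.
    apply: eq_bigr => i _; rewrite mulrnDr; congr (_ + _).
    apply/eqP; rewrite eq_sym -subr_eq0 opprK -mulrnDr -mulnSr prednK //.
    by rewrite mulnC mulrnA rhoN mul0rn.
  - have xs : x \in (s : seq G) by rewrite in_fset_set //; apply: mem_set.
    have xm := xs; rewrite -index_mem in xm.
    exists (fun i => (i == Ordinal xm) : nat); rewrite (bigD1 (Ordinal xm)) //= eqxx nth_index //.
    by rewrite big1 ?addr0 // => i /negPf ->.
apply: sub_finite_set (finite_image F (@finite_finset _ [set: _])) => x /= /p_ker /rho_id <-.
by have [c ->] := rhoF x; exists c.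
Qed.

(** * Growth functions of lattices *)

(** The generators are the signed standard basis vectors; a word of length at most
[r] in them has all its coordinates between [-r] and [r]. *)
Lemma standard_growth sym d : exists2 f, growths sym {ffun 'I_d -> int} f &
  forall r, (f r <= (2 * r).+1 ^ d)%N.
Proof.
pose V : zmodType := {ffun 'I_d -> int}.
pose e i : V := [ffun j => (j == i)%:Z].
pose S := (e @` setT) `|` ((fun i => - e i) @` setT).
have finS : finite_set S.
  by rewrite finite_setU; split; apply/finite_image/finite_finset.
have symS : symmetric_subset S.
  by move=> x [] [i _ <-]; [right|left]; exists i; rewrite ?opprK.
have genS : monoid_generating S.
  have add0 : exists n, word_of_length S n 0 by exists 0%N; apply/word_of_length0.
  have addD x y : (exists n, word_of_length S n x) ->
      (exists n, word_of_length S n y) -> exists n, word_of_length S n (x + y).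
    by move=> [m Sx] [n Sy]; exists (m + n)%N; apply: word_of_lengthD.
  have addM x n : S x -> exists m, word_of_length S m (x *+ n).
    move=> Sx; elim: n => // n IH; rewrite mulrS; apply: addD => //.
    by exists 1%N; apply: word_of_length1.
  move=> x; have -> : x = \sum_i e i *~ x i.
    apply/ffunP => j; rewrite sum_ffunE (bigD1 j) //= big1 ?addr0.
      by rewrite ffunMzE ffunE eqxx intz.
    move=> i ij; rewrite ffunMzE ffunE.
    by rewrite eq_sym (negPf ij) mul0rz.
  apply: (big_ind (fun x => exists n, word_of_length S n x)) => // i _.
  case: (x i) => n; first by apply: addM; left; exists i.
  by rewrite NegzE mulrNz -mulNrz; apply: addM; right; exists i.
exists (growth S) => [|r]; first by exists S.
have <- : #|{ffun 'I_d -> 'I_(2 * r).+1}| = ((2 * r).+1 ^ d)%N.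
  by rewrite card_ffun !card_ord.
rewrite -card_fset_setT.
pose F (u : {ffun 'I_d -> 'I_(2 * r).+1}) : V := [ffun i => (u i)%:Z - r%:Z].
apply: (leq_fset_set_surj (f := F)); first exact: finite_finset.
move=> x /(ballP _ _ genS)[n nr Sx].
have x_le i : (`|x i| <= n)%N.
  elim: n x Sx {nr} => [|n IH] x; first by move=> /word_of_length0 ->; rewrite ffunE.
  move=> /word_of_lengthS[s [y [Ss /IH yn ->]]]; rewrite ffunE.
  have {Ss} : (`|s i| <= 1)%N by case: Ss => -[j _ <-]; rewrite !ffunE; case: eqP.
  by move: (s i : int) (y i : int) yn => u v; lia.
exists [ffun i => inord `|(x i + r%:Z)%R|] => //.
apply/ffunP => i; rewrite !ffunE; move: (x i : int) (x_le i) => u ule.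
by rewrite inordK; lia.
Qed.

(** Over the rationals the rows of the matrix of generators span the whole
space, so some [d] of them form an invertible matrix. *)
Lemma generating_independent d (S : set {ffun 'I_d -> int}) :
  finite_set S -> monoid_generating S ->
  exists2 s : 'I_d -> {ffun 'I_d -> int}, forall i, S (s i) &
    forall c c' : 'I_d -> nat, \sum_i s i *+ c i = \sum_i s i *+ c' i ->
      c =1 c'.
Proof.
move=> finS genS.
pose V : zmodType := {ffun 'I_d -> int}.
pose q (x : V) : 'rV[rat]_d := \row_j (x j)%:~R.
have qD x y : q (x + y) = q x + q y.
  by apply/rowP => j; rewrite !mxE ffunE rmorphD.
have q0 : q 0 = 0 by apply/rowP => j; rewrite !mxE ffunE.
have qMn x n : q (x *+ n) = n%:R *: q x.
  elim: n => [|n IH]; first by rewrite mulr0n q0 scale0r.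
  by rewrite mulrS qD IH [n.+1%:R]mulrS scalerDl scale1r.
pose s := fset_set S; pose A := \matrix_(i < size s) q s`_i.
have qA x : (q x <= A)%MS.
  have [n] := genS x; move: x.
  apply: word_of_length_ind => [|x y Sx Ay]; first by rewrite q0 sub0mx.
  have xs : x \in (s : seq V) by rewrite in_fset_set //; apply: mem_set.
  have xm := xs; rewrite -index_mem in xm.
  rewrite qD addmx_sub //; have <- : row (Ordinal xm) A = q x.
    by rewrite rowK nth_index.
  exact: row_sub.
have fullA : row_full A.
  rewrite -sub1mx; apply/row_subP => i.
  have <- : q [ffun j => (i == j)%:Z] = row i 1%:M.
    by apply/rowP => j; rewrite !mxE ffunE; case: eqP.
  exact: qA.
pose f := fullrankfun fullA.
exists (fun i => s`_(f i)) => [i|c c' e i].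
  have : s`_(f i) \in (s : seq V) by apply: mem_nth.
  by rewrite in_fset_set // => /set_mem.
have freeB : row_free (rowsub f A) by rewrite row_free_unit -row_full_unit fullrowsub_full.
pose w (c : 'I_d -> nat) : 'rV[rat]_d := \row_i (c i)%:R.
have wE c0 : w c0 *m rowsub f A = q (\sum_i s`_(f i) *+ c0 i).
  rewrite (big_morph q qD q0) mulmx_sum_row; apply: eq_bigr => j _.
  by rewrite qMn mxE row_rowsub rowK.
have /(row_free_inj freeB)/rowP/(_ i) : w c *m rowsub f A = w c' *m rowsub f A.
  by rewrite !wE e.
by rewrite !mxE => /eqP; rewrite eqr_nat => /eqP.
Qed.

(** The combinations of [d] independent generators with coefficients in
[{0, ..., r}] are distinct and have length at most [d * r]. *)
Lemma lattice_growth_lower sym d f : growths sym {ffun 'I_d -> int} f ->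
  forall r, (r.+1 ^ d <= f (d * r))%N.
Proof.
move=> [S [finS _ genS] <-] r.
have [s Ss s_inj] := generating_independent finS genS.
have <- : #|{ffun 'I_d -> 'I_r.+1}| = (r.+1 ^ d)%N by rewrite card_ffun !card_ord.
rewrite -card_fset_setT.
apply: (leq_fset_set_inj (f := fun c : {ffun 'I_d -> 'I_r.+1} => \sum_i s i *+ c i)).
- exact: finite_finset.
- exact: finite_ball.
- by move=> c c' _ _ /s_inj e; apply/ffunP => i; apply: val_inj; apply: e.
- move=> c _; have -> : (d * r = \sum_(i < d) r)%N by rewrite sum_nat_const card_ord.
  apply: ball_sum => // i; apply: ball_le (leq_ord (c i)) _ _.
  exact: ballMn.
Qed.

(** * Comparison of the invariants *)

Lemma expn_dominated K m n :
  (forall r, r.+1 ^ m <= K * r.+1 ^ n)%N -> (m <= n)%N.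
Proof.
move=> le_mn; rewrite leqNgt; apply/negP => lt_nm.
have := leq_trans (leq_pexp2l (ltn0Sn K) lt_nm) (le_mn K).
by rewrite expnS leq_pmul2r ?ltnn // expn_gt0.
Qed.

(** If [a < b], Bernoulli's inequality makes [(b / a) ^ n] at least
[(n + a) / a], which exceeds [C] for [n = a * C]. *)
Lemma expn_ratio_bounded a b C :
  (forall n, b ^ n <= C * a ^ n)%N -> (b <= a)%N.
Proof.
move=> bC; rewrite leqNgt; apply/negP => lt_ab.
have a0 : (0 < a)%N.
  by case: a lt_ab bC => // b0 /(_ 1%N); rewrite !expn1 muln0 leqn0 => /eqP b0'; rewrite b0' in b0.
have bernoulli n : ((n + a) * a ^ n <= a * b ^ n)%N.
  elim: n => [|n IH]; first by rewrite !expn0 add0n.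
  rewrite !expnSr [leqRHS]mulnA; apply: leq_trans (leq_mul IH (leqnn b)).
  apply: leq_trans (leq_mul (leqnn _) lt_ab); nia.
have := leq_trans (bernoulli (a * C)%N) (leq_mul (leqnn a) (bC _)).
by rewrite mulnA leq_pmul2r ?expn_gt0 ?a0 // -[X in (_ <= X)%N]addn0 leq_add2l leqn0 eqn0Ngt a0.
Qed.

Lemma tors_extension (H : zmodType) : finitely_generated H ->
  exists2 p : {additive H -> {ffun 'I_(rk H) -> int}},
    (forall y, exists x, p x = y) &
    finite_set [set x | p x = 0] /\ #|` fset_set [set x | p x = 0]| = card_tors H.
Proof.
move=> fgH; have [p p_surj p_ker] := tors_free_quotient fgH.
exists p => //; have -> : [set x | p x = 0] = [set` @tors H].
  by apply/seteqP; split=> x /p_ker.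
by split=> //; apply: finite_tors.
Qed.

Lemma card_tors_gt0 (H : zmodType) : finitely_generated H -> (0 < card_tors H)%N.
Proof.
move=> fgH; rewrite /card_tors cardfs_gt0; apply/fset0Pn; exists 0.
by rewrite in_fset_set; [apply/mem_set/rpred0|apply: finite_tors].
Qed.

Section Comparison.
Variables (sym : bool) (G G' : zmodType).
Hypotheses (fgG : finitely_generated G) (fgG' : finitely_generated G').
Hypothesis growthsGG' : growths sym G `<=` growths sym G'.

(** This is the only place where the hypothesis on growth functions enters: the
pullback to [G] of a growth function of one lattice is also a growth function of
[G'], which is pushed forward to the other lattice. *)
Lemma growth_transfer f0 : growths sym {ffun 'I_(rk G) -> int} f0 ->
  exists2 f1, growths sym {ffun 'I_(rk G') -> int} f1 &
    exists k, forall r, (card_tors G' * f1 r <= card_tors G * f0 (r + k))%N.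
Proof.
move=> f0P; have [p p_surj [finK cardK]] := tors_extension fgG.
have [p' p'_surj [finK' cardK']] := tors_extension fgG'.
have [f /growthsGG' fP f_le] := growths_pullback p_surj finK f0P.
have [f1 f1P [k f1_le]] := growths_pushforward p'_surj finK' fP.
exists f1 => //; exists k => r; rewrite -cardK -cardK'.
exact: leq_trans (f1_le r) (f_le _).
Qed.

Lemma leq_rk : (rk G' <= rk G)%N.
Proof.
have [f0 f0P f0_le] := standard_growth sym (rk G).
have [f1 f1P [k f1_le]] := growth_transfer f0P.
have f1_ge := lattice_growth_lower f1P.
(* The constant satisfies 2 (d' r + k) + 1 <= c (r + 1) for all r. *)
pose c := (2 * rk G' + 2 * k).+1.
apply: (@expn_dominated (card_tors G * c ^ rk G)) => r.
apply: leq_trans (f1_ge r) _; apply: leq_trans (leq_pmull _ (card_tors_gt0 fgG')) _.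
apply: leq_trans (f1_le _) _; rewrite -mulnA leq_mul2l -expnMn; apply/orP; right.
apply: leq_trans (f0_le _) _; case: (rk G) => // d; rewrite leq_exp2r // /c; nia.
Qed.

(** When the ranks agree, a transfer starts and ends on the same lattice and can
be repeated; each repetition gains a factor [card_tors G' / card_tors G], while the
growth functions involved all obey the same polynomial lower bound.  The
accumulated shift [k] is absorbed by evaluating at [r = k]. *)
Lemma leq_card_tors : rk G = rk G' -> (card_tors G' <= card_tors G)%N.
Proof.
move=> eq_rk; set d := rk G.
have [f0 f0P f0_le] := standard_growth sym d.
have iterate n : exists2 f1, growths sym {ffun 'I_d -> int} f1 &
    exists k, forall r, (card_tors G' ^ n * f1 r <= card_tors G ^ n * f0 (r + k))%N.
  elim: n => [|n [f fP [k f_le]]].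
    by exists f0 => //; exists 0%N => r; rewrite !expn0 addn0.
  have [f1] := growth_transfer fP; rewrite -eq_rk => f1P [k1 f1_le].
  exists f1 => //; exists (k1 + k)%N => r.
  rewrite expnSr -mulnA; apply: leq_trans (leq_mul (leqnn _) (f1_le r)) _.
  by rewrite mulnCA expnS -[leqRHS]mulnA leq_mul2l addnA f_le orbT.
(* At r = k the upper bound is 2 (d k + k) + 1 <= (2 d + 2) (k + 1). *)
apply: (@expn_ratio_bounded _ _ ((2 * d).+2 ^ d)) => n.
have [f1 /lattice_growth_lower f1_ge [k f1_le]] := iterate n.
have k0 : (0 < k.+1 ^ d)%N by rewrite expn_gt0.
rewrite -(leq_pmul2r k0); apply: leq_trans (leq_mul (leqnn _) (f1_ge k)) _.
apply: leq_trans (f1_le _) _; rewrite mulnAC mulnC leq_mul2r -expnMn; apply/orP; right.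
apply: leq_trans (f0_le _) _; case: (d) => // e; rewrite leq_exp2r //; nia.
Qed.

End Comparison.

Lemma growths_determine sym (G G' : zmodType) :
  finitely_generated G -> finitely_generated G' ->
  growths sym G = growths sym G' ->
  rk G = rk G' /\ card_tors G = card_tors G'.
Proof.
move=> fgG fgG' eqGG'.
have sub : growths sym G `<=` growths sym G' by rewrite eqGG'.
have sub' : growths sym G' `<=` growths sym G by rewrite eqGG'.
have eq_rk : rk G = rk G' by apply/eqP; rewrite eqn_leq !(leq_rk _ _ sub, leq_rk _ _ sub').
split=> //; apply/eqP; rewrite eqn_leq (leq_card_tors fgG fgG' sub eq_rk).
by rewrite (leq_card_tors fgG' fgG sub' (esym eq_rk)).
Qed.

Theorem corollary1p8 (G G' : zmodType)
    (fgG : finitely_generated G) (fgG' : finitely_generated G') :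
  (symmetric_growth_functions G = symmetric_growth_functions G' ->
     rk G = rk G' /\ card_tors G = card_tors G') /\
  (monoid_growth_functions G = monoid_growth_functions G' ->
     rk G = rk G' /\ card_tors G = card_tors G').
Proof.
rewrite !symmetric_growthsE !monoid_growthsE.
by split; apply: growths_determine.
Qed.
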